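(* Let $\gamma_1:G_1\times I'_1\to I'_1$ be the action of $G_1$ on $I'_1$ given, for $g_1\in G_1$ with parameters $(q_1,t_1,x_1,s_1)$ and $f\in I'_1$, by $$(\gamma_1(g_1)\cdot f)(t,x)=q_1 f\left(\frac{t-t_1}{q_1^2},\frac{x-x_1}{q_1}\right)+s_1 .$$ Then $\gamma_1$ globalizes the local actions of the one-parameter groups generated by the basis elements $X_1,X_2,X_3,X_4$ of $\mathfrak{g}$ (with $X_i$ corresponding to $\xi_i\in\mathrm{Lie}(G_1)$, $1\le i\le 4$).
   Context: $\mathfrak{g}$ is the Lie algebra of vector fields on $\mathbb{R}^3$ (coordinates $t,x,v$) spanned by $$X_1=\frac{\partial}{\partial t},\quad X_2=\frac{\partial}{\partial x},\quad X_3=\frac{\partial}{\partial v},\quad X_4=2t\frac{\partial}{\partial t}+x\frac{\partial}{\partial x}+v\frac{\partial}{\partial v};$$ it is the Lie point symmetry algebra of the nonlinear filtration equation $v_t=k(v_x)v_{xx}$, $k'(v_x)\ne0$, for generic $k$. $G_1$ is the solvable Lie group of matrices $$\begin{pmatrix} q^2 & 0 & 0 & t \\ 0 & q &0 & x \\ 0 & 0 &q & s \\ 0 & 0 &0 & 1 \end{pmatrix},\qquad s,t,x\in\mathbb{R},\ q\in\mathbb{R}^{>0};$$ such a matrix is said to have parameters $(q,t,x,s)$. $P_1\subset G_1$ is the subgroup of elements with $t=x=0$, and $\chi_1$ is the character of $P_1$ sending the element with parameters $(q,0,0,s)$ to $q$. $n_{t,x}$ is the element with parameters $(1,t,x,0)$.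 $I_1$ is the space of smooth real-valued $\varphi$ on $G_1$ with $\varphi(gp)=\chi_1(p)^{-1}\varphi(g)$ for all $g\in G_1,p\in P_1$, and $I'_1$ is the space of all $f\in C^\infty(\mathbb{R}^2)$ of the form $f(t,x)=\varphi(n_{t,x})$ with $\varphi\in I_1$ (in fact $I'_1=C^\infty(\mathbb{R}^2)$). With $E_{ij}$ the $4\times4$ matrix units, $\xi_1=E_{14}$, $\xi_2=E_{24}$, $\xi_3=E_{34}$, $\xi_4=\mathrm{diag}(2,1,1,0)$ in $\mathrm{Lie}(G_1)$. Local action of a vector field: if $X$ is a vector field on $\mathbb{R}^3$ with flow $\exp(\epsilon X)$ and $f$ is a smooth function on $\mathbb{R}^2$ with graph $\Gamma_f=\{(t,x,f(t,x))\}$, then $\exp(\epsilon X)\cdot f$ is the function whose graph is $\exp(\epsilon X)(\Gamma_f)$, whenever this is the graph of a function. An action $\gamma$ of a Lie group $G$ on a space of functions globalizes the local actions generated by vector fields $X_i$ (with $X_i$ corresponding to $\xi_i\in\mathrm{Lie}(G)$) if, for every $i$ and every $f$ in the space, $\gamma(\exp(\epsilon\xi_i))\cdot f=\exp(\epsilon X_i)\cdot f$ for all $\epsilon\in\mathbb{R}$ for which the right side is defined. *)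

(* Defs.v *)
From HB Require Import structures.
From mathcomp Require Import all_boot all_order all_algebra.
From mathcomp Require Import all_classical all_reals all_analysis.

Set Implicit Arguments.
Unset Strict Implicit.
Unset Printing Implicit Defensive.

Import Order.TTheory GRing.Theory Num.Theory.
Import numFieldNormedType.Exports.

Local Open Scope classical_set_scope.
Local Open Scope ring_scope.

(* The point of R^n with the listed coordinates. *)
Definition pt (R : realType) (n : nat) (s : seq R) : 'rV[R]_n :=
  \row_(i < n) s`_i.

Fixpoint iter_partial (R : realType) (n : nat) (s : seq 'I_n.+1)
    (f : 'rV[R]_n.+1 -> R) : 'rV[R]_n.+1 -> R :=
  if s is i :: s' then
    fun y => 'D_(delta_mx 0 i) (iter_partial s' f) y
  else f.

(* C^oo on an open set U: all partial derivatives of all orders exist and are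
   continuous at every point of U.  As 'D is total, the existence of each of
   them has to be required separately.  U must be open for the values of f
   outside U to be irrelevant. *)
Definition smooth_on (R : realType) (n : nat) (U : set 'rV[R]_n.+1)
    (f : 'rV[R]_n.+1 -> R) : Prop :=
  forall s : seq 'I_n.+1, forall y, U y ->
    {for y, continuous (iter_partial s f)} /\
    forall i, derivable (iter_partial s f) y (delta_mx 0 i).

Definition smooth2 (R : realType) (f : R -> R -> R) : Prop :=
  smooth_on setT (fun y : 'rV[R]_2 => f (y 0 0) (y 0 1)).

Definition expmx (R : realType) (n : nat) (A : 'M[R]_n.+1) : 'M[R]_n.+1 :=
  limn (series (fun k : nat => (k`!%:R)^-1 *: A ^+ k)).

Definition lie_algebra (R : realType) (n : nat) (G : set 'M[R]_n.+1) :
    set 'M[R]_n.+1 :=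
  [set A | forall e : R, G (expmx (e *: A))].

(* gamma is total; only its values on G and E matter. *)
Definition is_action (R : realType) (n : nat) (G : set 'M[R]_n.+1)
    (E : set (R -> R -> R))
    (gamma : 'M[R]_n.+1 -> (R -> R -> R) -> (R -> R -> R)) : Prop :=
  [/\ forall g f, G g -> E f -> E (gamma g f),
      forall f, E f -> gamma 1 f = f &
      forall g h f, G g -> G h -> E f ->
        gamma (g * h) f = gamma g (gamma h f)].

(* flow X e p q says that q = exp(e X) p: some integral curve of X, defined on
   an open interval containing 0 and e, goes from p at time 0 to q at time e. *)
Definition flow (R : realType) (X : 'rV[R]_3 -> 'rV[R]_3) (e : R)
    (p q : 'rV[R]_3) : Prop :=
  exists (a b : R) (c : R -> 'rV[R]_3),
    [/\ a < 0 < b, a < e < b, c 0 = p, c e = q &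
        forall r : R, a < r < b -> is_derive r 1 c (X (c r))].

Definition flow_dom (R : realType) (X : 'rV[R]_3 -> 'rV[R]_3) (e : R) :
    set 'rV[R]_3 :=
  [set p | exists q, flow X e p q].

Definition flow_image (R : realType) (X : 'rV[R]_3 -> 'rV[R]_3) (e : R)
    (S : set 'rV[R]_3) : set 'rV[R]_3 :=
  [set q | exists2 p, S p & flow X e p q].

Definition graph (R : realType) (f : R -> R -> R) : set 'rV[R]_3 :=
  [set p | exists t x : R, p = pt 3 [:: t; x; f t x]].

Definition is_function_graph (R : realType) (S : set 'rV[R]_3) : Prop :=
  forall t x v w : R,
    S (pt 3 [:: t; x; v]) -> S (pt 3 [:: t; x; w]) -> v = w.

Definition local_action_defined (R : realType) (X : 'rV[R]_3 -> 'rV[R]_3)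
    (e : R) (f : R -> R -> R) : Prop :=
  graph f `<=` flow_dom X e /\ is_function_graph (flow_image X e (graph f)).

(* The function exp(e X) . f might have a domain smaller than R^2, so that the
   equality gamma (exp (e xi_i)) f = exp(e X_i) . f is expressed as an equality
   of graphs. *)
Definition globalizes (R : realType) (n : nat) (I : Type)
    (G : set 'M[R]_n.+1) (E : set (R -> R -> R))
    (gamma : 'M[R]_n.+1 -> (R -> R -> R) -> (R -> R -> R))
    (xi : I -> 'M[R]_n.+1) (X : I -> 'rV[R]_3 -> 'rV[R]_3) : Prop :=
  [/\ is_action G E gamma,
      forall i, lie_algebra G (xi i) &
      forall i f (e : R), E f -> local_action_defined (X i) e f ->
        graph (gamma (expmx (e *: xi i)) f) = flow_image (X i) e (graph f)].

Definition Xfield (R : realType) (i : 'I_4) (p : 'rV[R]_3) : 'rV[R]_3 :=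
  let t := p 0 0 in let x := p 0 1 in let v := p 0 2 in
  nth 0 [:: pt 3 [:: 1; 0; 0];
            pt 3 [:: 0; 1; 0];
            pt 3 [:: 0; 0; 1];
            pt 3 [:: 2 * t; x; v]] i.

Definition G1mx (R : realType) (q t x s : R) : 'M[R]_4 :=
  \matrix_(i, j) (nth [::] [:: [:: q ^+ 2; 0; 0; t];
                               [:: 0;      q; 0; x];
                               [:: 0;      0; q; s];
                               [:: 0;      0; 0; 1]] i)`_j.

Definition G1 (R : realType) : set 'M[R]_4 :=
  [set g | exists q t x s : R, 0 < q /\ g = G1mx q t x s].

Definition par_q (R : realType) (g : 'M[R]_4) : R := g 1 1.
Definition par_t (R : realType) (g : 'M[R]_4) : R := g 0 3.
Definition par_x (R : realType) (g : 'M[R]_4) : R := g 1 3.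
Definition par_s (R : realType) (g : 'M[R]_4) : R := g 2 3.

Definition xi1 (R : realType) (i : 'I_4) : 'M[R]_4 :=
  nth 0 [:: delta_mx 0 3; delta_mx 1 3; delta_mx 2 3;
            diag_mx (pt 4 [:: 2; 1; 1; 0])] i.

Definition P1 (R : realType) : set 'M[R]_4 :=
  [set g | [/\ G1 g, par_t g = 0 & par_x g = 0]].

Definition chi1 (R : realType) (p : 'M[R]_4) : R := par_q p.

Definition n_tx (R : realType) (t x : R) : 'M[R]_4 := G1mx 1 t x 0.

(* Smoothness on G_1, in the global chart (q, t, x, s). *)
Definition smooth_G1 (R : realType) (phi : 'M[R]_4 -> R) : Prop :=
  smooth_on [set y : 'rV[R]_4 | 0 < y 0 0]
    (fun y => phi (G1mx (y 0 0) (y 0 1) (y 0 2) (y 0 3))).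

(* Functions on G_1 are represented by functions on all matrices, of which only
   the restriction to G_1 is constrained or used. *)
Definition I1 (R : realType) : set ('M[R]_4 -> R) :=
  [set phi | smooth_G1 phi /\
    forall g p, G1 g -> P1 p -> phi (g * p) = (chi1 p)^-1 * phi g].

Definition I1' (R : realType) : set (R -> R -> R) :=
  [set f | smooth2 f /\
    exists2 phi, @I1 R phi & forall t x, f t x = phi (n_tx t x)].

Definition gamma1 (R : realType) (g : 'M[R]_4) (f : R -> R -> R) :
    R -> R -> R :=
  fun t x =>
    par_q g * f ((t - par_t g) / par_q g ^+ 2) ((x - par_x g) / par_q g)
    + par_s g.

(* Main.v *)
Require Import Defs.
From mathcomp Require Import all_boot all_order all_algebra.
From mathcomp Require Import all_classical all_reals all_analysis.
From mathcomp Require Import ring.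

Set Implicit Arguments.
Unset Strict Implicit.
Unset Printing Implicit Defensive.

Import Order.TTheory GRing.Theory Num.Theory.
Import numFieldNormedType.Exports.

Local Open Scope classical_set_scope.
Local Open Scope ring_scope.

(** The group G_1 acts on R^3 by the affine maps
      (t, x, v) |-> (q^2 t + t_1, q x + x_1, q v + s_1),
    and gamma_1(g) f is by construction the function whose graph is the image
    of the graph of f under g ([graph_gamma1]).  So everything comes down to
    two facts about this action on R^3.

    First, it integrates the fields X_i: the flow of X_i at time e is the
    action of exp(e xi_i) ([flow_Xfield]).  Each X_i is affine with diagonal
    linear part, so its integral curves solve three decoupled scalar equations
    u' = a u + b with a b = 0; by uniqueness for linear equations
    ([linear_ode_unique]) they are e |-> e^(a e) u(0) + b e
    ([flow_diag_affineP]).  On the group side, xi_1, xi_2, xi_3 have square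
    zero and xi_4 is diagonal, so the exponential series can be summed
    ([expmx_xi1]).  Hence the image of the graph of f under the flow of X_i at
    time e is the graph of gamma_1(exp(e xi_i)) f, for every e and every f.

    Second, gamma_1 is an action of G_1 on I'_1.  Its compatibility with products
    reflects that of the affine maps; the point is that it preserves I'_1.  An
    element of G_1 with parameters
    (q, t, x, s) is the product of n_{t,x} and the element of P_1 with
    parameters (q, 0, 0, s); hence a function phi in I_1 is determined by
    f(t, x) = phi(n_{t,x}) through phi = f(t, x) / q.  Conversely this formula
    defines a smooth phi for every smooth f, so I'_1 is all of C^oo(R^2)
    ([I1'P]), and it remains to see that gamma_1(g) f is smooth.  Smoothness
    is here the existence and continuity of all iterated partial derivatives;
    it is obtained from [smooth_on_class]: if a class of continuous functions
    contains the partial derivatives of its members, all its members are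
    smooth. *)

(** * Limits of matrices and directional derivatives *)

(** The norm of a matrix is the maximum of its finitely many entries, so that
    the eventual bounds on the entries hold simultaneously. *)
Lemma cvg_mx (R : realType) (T : Type) (F : set_system T) (FF : Filter F)
    (m n : nat) (u : T -> 'M[R]_(m, n)) (M : 'M[R]_(m, n)) :
  (forall i j, u x i j @[x --> F] --> M i j) -> u @ F --> M.
Proof.
move=> uM; apply/cvgrPdist_le => /= e e0; near=> k.
rewrite /Num.Def.normr/= mx_normrE (bigmax_le _ (ltW e0))//= => ij _.
rewrite !mxE; move: ij; near: k; apply: filter_forall => -[i j] /=.
exact: ((cvgrPdist_le _ _).1 (uM i j)).
Unshelve. all: by end_near. Qed.

Lemma is_derive1P (R : realType) (V W : normedModType R) (f : V -> W)
    (x v : V) (d : W) :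
  is_derive x v f d <-> is_derive (0 : R) 1 (fun h => f (h *: v + x)) d.
Proof.
have E : 'D_v f x = 'D_1 (fun h : R => f (h *: v + x)) 0.
  rewrite /derive; set g1 := fun h => h^-1 *: _; set g2 := fun h => h^-1 *: _.
  suff -> : g1 = g2 by [].
  apply/funext => h; rewrite /g1 /g2 /=.
  by rewrite addr0 scale0r add0r [_%:A]mulr1.
split=> -[fx <-]; split; rewrite ?E//.
  exact: (proj1 (derivable1P _ _ _) fx).
exact: (proj2 (derivable1P _ _ _) fx).
Qed.

(** A maps the line y + R v to a line with direction w, at speed c, so this is
    the chain rule for functions of one real variable; the existence of partial
    derivatives can be transported with it. *)
Lemma is_derive_comp_line (R : realType) (V W : normedModType R) (f : W -> R)
    (A : V -> W) (y v : V) (w : W) (c d : R) :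
    (forall h : R, A (h *: v + y) = (h * c) *: w + A y) ->
  is_derive (A y) w f d -> is_derive y v (f \o A) (c * d).
Proof.
move=> Aline /is_derive1P fd; apply/is_derive1P.
pose g (h : R) := f (h *: w + A y).
rewrite (_ : (fun _ => _) = g \o (fun h : R => h * c)); last first.
  by apply/funext => h /=; rewrite Aline.
rewrite mulrC; apply: is_derive1_comp; first by rewrite mul0r.
rewrite (_ : (fun _ => _) = c \*: (@id R)); last first.
  by apply/funext => h /=; rewrite mulrC.
by apply: is_derive_eq; rewrite [_%:A]mulr1.
Qed.

(** * Smooth functions on an open subset of R^n *)

(** The coinductive principle for smoothness: by induction on the list of
    directions, every iterated partial derivative of a member of C agrees on U
    with a member of C.  Agreement on U is enough because U is open and
    derivatives are local. *)
Lemma smooth_on_class (R : realType) (n : nat) (U : set 'rV[R]_n.+1)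
    (C : set ('rV[R]_n.+1 -> R)) :
    open U ->
    (forall g y, C g -> U y -> {for y, continuous g}) ->
    (forall g i, C g -> exists2 g', C g' &
       forall y, U y -> is_derive y (delta_mx 0 i) g (g' y)) ->
  forall g, C g -> smooth_on U g.
Proof.
move=> Uop Ccont Cder g Cg s.
have [k Ck gk] : exists2 k, C k & forall y, U y -> iter_partial s g y = k y.
  elim: s => [|i s [k Ck gk]]; first by exists g.
  have [k' Ck' kk'] := Cder k i Ck.
  exists k' => // y Uy /=; have [_ <-] := kk' y Uy.
  apply: near_eq_derive; near=> z; apply: gk.
  by near: z; exact: open_nbhs_nbhs.
move=> y Uy; have near_gk : \near y, k y = iter_partial s g y.
  by near=> z; rewrite gk//; near: z; exact: open_nbhs_nbhs.
split=> [|i].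
  rewrite /prop_for /continuous_at gk//.
  apply: cvg_trans (Ccont k y Ck Uy).
  exact: (@near_eq_cvg _ _ (nbhs y) _ _ _ near_gk).
have [k' _ /(_ y Uy)[ky _]] := Cder k i Ck.
exact: near_eq_derivable ky.
Unshelve. all: by end_near. Qed.

Lemma iter_partial_rcons (R : realType) (n : nat) (s : seq 'I_n.+1) i
    (f : 'rV[R]_n.+1 -> R) :
  iter_partial s (iter_partial [:: i] f) = iter_partial (rcons s i) f.
Proof. by elim: s => //= j s ->. Qed.

Lemma smooth_on_partial (R : realType) (n : nat) (U : set 'rV[R]_n.+1) i
    (f : 'rV[R]_n.+1 -> R) :
  smooth_on U f -> smooth_on U (iter_partial [:: i] f).
Proof. by move=> fU s y Uy; rewrite iter_partial_rcons; exact: fU. Qed.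

Lemma smooth_on_is_derive (R : realType) (n : nat) (U : set 'rV[R]_n.+1) i
    (f : 'rV[R]_n.+1 -> R) y :
  smooth_on U f -> U y ->
  is_derive y (delta_mx 0 i) f (iter_partial [:: i] f y).
Proof. by move=> fU /(fU [::])[_ df]; exact/derivableP. Qed.

(** By the Leibniz rule, a partial derivative of a product of smooth functions
    is a sum of two such products; closing the products under addition makes
    [smooth_on_class] applicable to them. *)
Inductive product_sum (R : realType) (n : nat) (U : set 'rV[R]_n.+1) :
    set ('rV[R]_n.+1 -> R) :=
| product_sumM f g : smooth_on U f -> smooth_on U g -> product_sum U (f * g)
| product_sumD f g :
    product_sum U f -> product_sum U g -> product_sum U (f + g).

Lemma product_sum_smooth (R : realType) (n : nat) (U : set 'rV[R]_n.+1) f :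
  open U -> product_sum U f -> smooth_on U f.
Proof.
move=> Uop; apply: smooth_on_class => // {f} [f y|f i]; elim=> {f} f g.
- move=> /(_ [::] y) fU /(_ [::] y) gU Uy.
  by apply: continuousM; [case: (fU Uy)|case: (gU Uy)].
- by move=> _ fc _ gc Uy; apply: continuousD; [exact: fc|exact: gc].
- move=> fU gU.
  exists (f * iter_partial [:: i] g + g * iter_partial [:: i] f).
    have pM h k : smooth_on U h -> smooth_on U k ->
      product_sum U (h * iter_partial [:: i] k).
      by move=> hU kU; exact: product_sumM hU (smooth_on_partial i kU).
    exact: product_sumD (pM _ _ fU gU) (pM _ _ gU fU).
  move=> y Uy; apply: is_deriveM; exact: smooth_on_is_derive Uy.
- move=> _ [f' Cf' ff'] _ [g' Cg' gg'].
  exists (f' + g'); first exact: product_sumD.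
  by move=> y Uy; apply: is_deriveD; [exact: ff'|exact: gg'].
Qed.

Lemma smooth_on_cst (R : realType) (n : nat) (U : set 'rV[R]_n.+1) (c : R) :
  open U -> smooth_on U (cst c).
Proof.
move=> Uop; apply: (@smooth_on_class _ _ _ [set cst a | a in setT]) => //.
- by move=> _ y [a _ <-] _; exact: cst_continuous.
- move=> _ i [a _ <-]; exists (cst 0); first by exists 0.
  by move=> y _; exact: is_derive_cst.
Qed.

Lemma smooth_onM (R : realType) (n : nat) (U : set 'rV[R]_n.+1) f g :
  open U -> smooth_on U f -> smooth_on U g -> smooth_on U (f * g).
Proof.
by move=> Uop fU gU; apply: product_sum_smooth => //; exact: product_sumM.
Qed.

Lemma smooth_onD (R : realType) (n : nat) (U : set 'rV[R]_n.+1) f g :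
  open U -> smooth_on U f -> smooth_on U g -> smooth_on U (f + g).
Proof.
move=> Uop fU gU; apply: product_sum_smooth => //.
(* f + g = f * 1 + g * 1 is a sum of products *)
have one : smooth_on U (1 : 'rV[R]_n.+1 -> R) by exact: smooth_on_cst.
by rewrite -[f]mulr1 -[g]mulr1; apply: product_sumD; exact: product_sumM.
Qed.

(** Affine substitutions that use each variable y_(k j) in one coordinate only:
    the rescalings of R^n and the coordinate projections.  Moving along an axis
    of the source moves along at most one axis of the target, so the partial
    derivatives of f \o A are multiples of those of f composed with A. *)
Lemma smooth_on_axis_affine (R : realType) (m n : nat)
    (U : set 'rV[R]_m.+1) (V : set 'rV[R]_n.+1) (f : 'rV[R]_n.+1 -> R)
    (k : 'I_n.+1 -> 'I_m.+1) (a b : 'I_n.+1 -> R) :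
    let A (y : 'rV[R]_m.+1) := \row_j (a j * y 0 (k j) + b j) in
    open U -> injective k -> (forall y, U y -> V (A y)) -> smooth_on V f ->
  smooth_on U (f \o A).
Proof.
move=> A Uop k_inj UV fV.
have Ac : continuous A.
  move=> y; apply: (@cvg_mx _ _ (nbhs y)) => i j; rewrite mxE.
  under eq_fun do rewrite mxE.
  apply: (@continuousD _ _ _ (fun z : 'rV[R]_m.+1 => a j * z 0 (k j))
    (cst (b j))); last exact: cst_continuous.
  apply: (@continuousM _ _ (cst (a j)) (fun z : 'rV[R]_m.+1 => z 0 (k j)));
    [exact: cst_continuous|exact: coord_continuous].
have Aaxis i : exists j c, forall y (h : R),
    A (h *: delta_mx 0 i + y) = (h * c) *: delta_mx 0 j + A y.
  have [j /eqP kj|nok] := pickP (fun j => k j == i).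
    exists j, (a j) => y h; apply/rowP => l; rewrite !mxE !eqxx /= -kj.
    rewrite (inj_eq k_inj); case: eqVneq => [->|_] /=; ring.
  (* A does not depend on y_i: any direction j does, with speed 0. *)
  exists 0, 0 => y h; apply/rowP => l; rewrite !mxE nok andbF /=; ring.
pose C := [set g | exists c s, g = cst c * (iter_partial s f \o A)].
apply: (@smooth_on_class _ _ _ C) => //.
- move=> _ y [c [s ->]] /UV/(fV s)[fc _].
  apply: continuousM; first exact: cst_continuous.
  exact: (@continuous_comp _ _ _ A _ y (Ac y) fc).
- move=> _ i [c [s ->]]; have [j [d Aj]] := Aaxis i.
  exists (cst (c * d) * (iter_partial (j :: s) f \o A)).
    by exists (c * d), (j :: s).
  move=> y /UV/(fV s)[_ /(_ j) df].
  have := is_derive_comp_line (Aj y) (derivableP df) => dfA.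
  apply: is_derive_eq; rewrite scaler0 addr0.
  by rewrite /cst /= [_ *: _]mulrA.
- by exists 1, [::]; rewrite /= -[LHS]mul1r.
Qed.

Lemma open_coord_gt0 (R : realType) (n : nat) (i : 'I_n.+1) :
  open [set y : 'rV[R]_n.+1 | 0 < y 0 i].
Proof.
rewrite (_ : mkset _ = (fun y : 'rV[R]_n.+1 => y 0 i) @^-1` [set x | 0 < x])//.
apply: open_comp; last exact: open_gt.
by move=> y _; exact: coord_continuous.
Qed.

(** A partial derivative of y_i^-k is zero or a multiple of y_i^-(k+1), hence
    the class C of all multiples of all negative powers. *)
Lemma smooth_on_coordV (R : realType) (n : nat) (i : 'I_n.+1) :
  smooth_on [set y : 'rV[R]_n.+1 | 0 < y 0 i] (fun y => (y 0 i)^-1).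
Proof.
pose C := [set g | exists c k, g = fun y : 'rV[R]_n.+1 => c * (y 0 i)^-1 ^+ k].
apply: (@smooth_on_class _ _ _ C).
- exact: open_coord_gt0.
- move=> _ y [c [k ->]] /= y0.
  apply: continuousM; first exact: cst_continuous.
  apply: (@continuous_comp _ _ _ (fun y : 'rV[R]_n.+1 => (y 0 i)^-1)
    (fun x => x ^+ k)); last exact: exprn_continuous.
  by apply: continuousV; [rewrite gt_eqF|exact: coord_continuous].
- move=> _ j [c [k ->]].
  exists (fun y => - c * k%:R * (j == i)%:R * (y 0 i)^-1 ^+ k.+1).
    by exists (- c * k%:R * (j == i)%:R), k.+1.
  move=> y /= y0; have yn0 : y 0 i != 0 by rewrite gt_eqF.
  have dy :
      is_derive y (delta_mx 0 j) (fun y : 'rV[R]_n.+1 => y 0 i) (j == i)%:R.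
    rewrite -[(j == i)%:R]mulr1.
    apply: (@is_derive_comp_line _ _ _ (@id R) (fun y : 'rV[R]_n.+1 => y 0 i)).
    by move=> h; rewrite !mxE eqxx /= eq_sym [_ *: 1]mulr1.
  have dyV : is_derive y (delta_mx 0 j) (fun y : 'rV[R]_n.+1 => (y 0 i)^-1)
      (- (y 0 i) ^- 2 *: (j == i)%:R).
    case: dy => dy1 dy2; split; first exact: derivableV.
    by rewrite deriveV// dy2.
  have -> : (fun y : 'rV[R]_n.+1 => c * (y 0 i)^-1 ^+ k) =
      c \*: ((fun y : 'rV[R]_n.+1 => (y 0 i)^-1) ^+ k).
    by apply/funext => z /=; rewrite exprfctE.
  apply: is_derive_eq; rewrite /GRing.scale /=.
  case: k => [|k]; first by rewrite !(mul0r, mulr0).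
  rewrite -exprVn /=.
  have alg (b a d : R) :
    c * (b * a ^+ k * (- a ^+ 2 * d)) = - c * b * d * a ^+ k.+2.
    by rewrite !exprS expr0; move: (a ^+ k) => e; ring.
  exact: alg.
- by exists 1, 1%N; apply/funext => y; rewrite mul1r expr1.
Qed.

(** * Flows of diagonal affine vector fields *)

Lemma is_derive_mxP (R : realType) (V : normedModType R) (m n : nat)
    (M : V -> 'M[R]_(m, n)) (x v : V) (D : 'M[R]_(m, n)) :
  is_derive x v M D <->
  forall i j, is_derive x v (fun y => M y i j) (D i j).
Proof.
split=> [[dM <-] i j|dM].
  by split; [exact: (proj1 (derivable_mxP _ _ _) dM)|rewrite derive_mx// mxE].
have dMx : derivable M x v by apply/derivable_mxP => i j; case: (dM i j).
split=> //; rewrite derive_mx//; apply/matrixP => i j.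
by rewrite mxE; case: (dM i j).
Qed.

Lemma is_derive0_itv_cst (R : realType) (l r : R) (w : R -> R) :
  (forall s, l < s < r -> is_derive s 1 w 0) ->
  forall x y, l < x < r -> l < y < r -> w x = w y.
Proof.
move=> dw x y; wlog xy : x y / x <= y => [hw xlr ylr|].
  by case: (leP x y) => [/hw|/ltW/hw h]; [exact|exact/esym/h].
move=> /andP[lx xr] /andP[ly yr]; apply/esym/eqP; rewrite -subr_eq0.
have inlr z : x <= z <= y -> l < z < r.
  by move=> /andP[xz zy]; rewrite (lt_le_trans lx xz) (le_lt_trans zy yr).
have dw' z : z \in `]x, y[ -> is_derive z 1 w (cst 0 z).
  rewrite in_itv /= => /andP[xz zy].
  by apply: dw; apply: inlr; rewrite !ltW.
have cw : {within `[x, y], continuous w}.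
  apply: derivable_within_continuous => z; rewrite in_itv /= => /inlr/dw.
  by case.
by have [z _ ->] := MVT_segment xy dw' cw; rewrite mul0r.
Qed.

(** The function u(s) e^(-a s) has derivative zero and vanishes at 0. *)
Lemma linear_ode_unique (R : realType) (a l r : R) (u : R -> R) :
    l < 0 < r -> (forall s, l < s < r -> is_derive s 1 u (a * u s)) ->
  u 0 = 0 -> forall s, l < s < r -> u s = 0.
Proof.
move=> lr0 du u0 s slr.
pose w := u * (expR \o (fun s => s * - a)).
have dw z : l < z < r -> is_derive z 1 w 0.
  move=> /du duz.
  have dl : is_derive z 1 (fun s : R => s * - a) (- a).
    rewrite (_ : (fun _ => _) = - a \*: (@id R)); last first.
      by apply/funext => h /=; rewrite mulrC.
    by apply: is_derive_eq; rewrite [_%:A]mulr1.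
  rewrite /w; apply: is_derive_eq; rewrite /GRing.scale /=; ring.
have := is_derive0_itv_cst dw slr lr0.
rewrite /w !mulrfctE u0 mul0r => /eqP; rewrite mulf_eq0 expR_eq0 orbF.
by move/eqP.
Qed.

(** The hypothesis says that each equation is either linear (b = 0) or has a
    constant right-hand side (a = 0); it makes one formula cover both cases. *)
Lemma is_derive_exp_affine (R : realType) (a b x s : R) : a * b = 0 ->
  is_derive s 1 (fun s => expR (s * a) * x + b * s)
    (a * (expR (s * a) * x + b * s) + b).
Proof.
move=> ab.
have dl : is_derive s 1 (fun s : R => s * a) a.
  rewrite (_ : (fun _ => _) = a \*: (@id R)); last first.
    by apply/funext => h /=; rewrite mulrC.
  by apply: is_derive_eq; rewrite [_%:A]mulr1.
rewrite (_ : (fun _ => _) =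
  x \*: (expR \o (fun s : R => s * a)) + b \*: (@id R)); last first.
  by apply/funext => h /=; rewrite mulrC.
apply: is_derive_eq; rewrite /GRing.scale /= mulrDr [a * (b * s)]mulrA ab.
ring.
Qed.

(** The coordinates decouple.  The difference between the j-th coordinate of an
    integral curve and the explicit solution satisfies u' = a_j u, u(0) = 0, so
    it vanishes on the whole interval of definition.  Conversely the explicit
    solution is defined on all of R, hence around 0 and e. *)
Lemma flow_diag_affineP (R : realType) (a b : 'I_3 -> R)
    (X : 'rV[R]_3 -> 'rV[R]_3) (e : R) (p q : 'rV[R]_3) :
    (forall j, a j * b j = 0) ->
    (forall p, X p = \row_j (a j * p 0 j + b j)) ->
  flow X e p q <-> q = \row_j (expR (e * a j) * p 0 j + b j * e).
Proof.
move=> ab XE; split=> [[l [r [c [l0r ler c0 ce dc]]]]|->].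
  apply/rowP => j; rewrite mxE -ce; apply/eqP; rewrite -subr_eq0; apply/eqP.
  pose phi s := expR (s * a j) * p 0 j + b j * s.
  pose u := (fun s => c s 0 j) - phi.
  apply: (@linear_ode_unique R (a j) l r u l0r _ _ e ler); last first.
    by rewrite /u /phi !fctE c0 mul0r expR0 mul1r mulr0 addr0 subrr.
  move=> s /dc /is_derive_mxP/(_ 0 j) dcj.
  have dphi := is_derive_exp_affine (p 0 j) s (ab j).
  apply: is_derive_eq; rewrite XE mxE /u /phi !fctE; ring.
pose phi s : 'rV[R]_3 := \row_j (expR (s * a j) * p 0 j + b j * s).
(* any bounded open interval containing 0 and e would do *)
exists (- (1 + `|e|)), (1 + `|e|), phi; split=> //.
- by rewrite oppr_lt0 !ltr_pwDl.
- by rewrite -ltr_norml ltrDr.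
- by apply/rowP => j; rewrite mxE mul0r expR0 mul1r mulr0 addr0.
- move=> s _; apply/is_derive_mxP => i j; rewrite ord1 XE mxE.
  rewrite (_ : (fun _ => _) = fun s => expR (s * a j) * p 0 j + b j * s).
    by rewrite mxE; exact: is_derive_exp_affine.
  by apply/funext => z; rewrite mxE.
Qed.

(** * Matrix exponentials *)

(** All terms of the series from the third on vanish. *)
Lemma expmx_sqr0 (R : realType) (n : nat) (A : 'M[R]_n.+1) :
  A ^+ 2 = 0 -> expmx A = 1 + A.
Proof.
move=> A2; apply: lim_near_cst; first exact: norm_hausdorff.
near=> k; have k2 : (2 <= k)%N by near: k; exact: nbhs_infty_ge.
rewrite -(subnKC k2) /series /= big_nat_recl// big_nat_recl// big1_seq ?addr0.
  by rewrite !fact0 !factS !fact0 invr1 !scale1r expr0 expr1.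
by move=> i _; rewrite -addn2 exprD A2 mulr0 scaler0.
Unshelve. all: by end_near. Qed.

Lemma diag_mxX (R : realType) (n k : nat) (d : 'rV[R]_n.+1) :
  diag_mx d ^+ k = diag_mx (map_mx (fun x => x ^+ k) d).
Proof.
elim: k => [|k IHk].
  rewrite expr0; apply/matrixP => i j; rewrite !mxE expr0; exact: esym.
rewrite exprS IHk -[LHS]/(_ *m _) mulmx_diag; congr diag_mx.
by apply/rowP => j; rewrite !mxE exprS.
Qed.

Lemma expmx_diag (R : realType) (n : nat) (d : 'rV[R]_n.+1) :
  expmx (diag_mx d) = diag_mx (map_mx expR d).
Proof.
apply: cvg_lim; first exact: norm_hausdorff.
apply: cvg_mx => i j.
rewrite (_ : (fun _ => _) = fun k => series (exp_coeff (d 0 i)) k *+ (i == j)).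
  rewrite !mxE; case: (i == j); last exact: cvg_cst.
  exact: is_cvg_series_exp_coeff.
apply/funext => k; rewrite /series /= summxE -sumrMnl; apply: eq_bigr => l _.
by rewrite diag_mxX !mxE mulrnAr mulrC.
Qed.

(** * The group G_1 and its action on R^3 *)

Lemma ptE (R : realType) (n : nat) (s : seq R) (i : 'I_n) :
  pt n s 0 i = s`_i.
Proof. by rewrite mxE. Qed.

Lemma G1mx_par (R : realType) (q t x s : R) :
  [/\ par_q (G1mx q t x s) = q, par_t (G1mx q t x s) = t,
      par_x (G1mx q t x s) = x & par_s (G1mx q t x s) = s].
Proof. by split; rewrite /par_q /par_t /par_x /par_s mxE. Qed.

Lemma G1mxM (R : realType) (q t x s q' t' x' s' : R) :
  G1mx q t x s * G1mx q' t' x' s' =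
  G1mx (q * q') (q ^+ 2 * t' + t) (q * x' + x) (q * s' + s).
Proof.
apply/matrixP => i j; rewrite -[LHS]/((_ *m _) i j) mxE !big_ord_recl big_ord0.
rewrite !mxE /=; case: i => -[|[|[|[|//]]]] ilt;
  case: j => -[|[|[|[|//]]]] jlt /=; ring.
Qed.

Lemma G1mx1 (R : realType) : G1mx 1 0 0 0 = 1 :> 'M[R]_4.
Proof.
apply/matrixP => i j; rewrite !mxE.
by case: i => -[|[|[|[|//]]]] ilt; case: j => -[|[|[|[|//]]]] jlt /=;
  rewrite ?expr1n.
Qed.

(** This is the standard affine action: G1_act g p lists the first three entries
    of the product of g with the column (p, 1). *)
Definition G1_act (R : realType) (g : 'M[R]_4) (p : 'rV[R]_3) : 'rV[R]_3 :=
  pt 3 [:: par_q g ^+ 2 * p 0 0 + par_t g; par_q g * p 0 1 + par_x g;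
           par_q g * p 0 2 + par_s g].

(** The function gamma_1(g) f evaluates f at the inverse image of (t, x) under
    the first two coordinates of g, and then applies the third one to the value;
    the third coordinate is affine in v alone. *)
Lemma graph_gamma1 (R : realType) (g : 'M[R]_4) (f : R -> R -> R) :
  G1 g -> graph (gamma1 g f) = G1_act g @` graph f.
Proof.
move=> [q [t [x [s [q0 ->]]]]]; have qn0 : q != 0 by rewrite gt_eqF.
rewrite /gamma1 /G1_act; have [-> -> -> ->] := G1mx_par q t x s.
apply/seteqP; split=> [_ [t' [x' ->]]|_ [_ [t' [x' ->]] <-]].
  exists (pt 3 [:: (t' - t) / q ^+ 2; (x' - x) / q;
                   f ((t' - t) / q ^+ 2) ((x' - x) / q)]).
    by exists ((t' - t) / q ^+ 2), ((x' - x) / q).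
  by rewrite !ptE /=; congr (pt 3 [:: _; _; _]); field.
exists (q ^+ 2 * t' + t), (q * x' + x).
rewrite !ptE /= !addrK ![_ * t' / _]mulrAC ![_ * x' / _]mulrAC.
by rewrite !divff ?expf_neq0// !mul1r.
Qed.

(** E_{i4} has square zero for i <> 4, and e xi_4 is diagonal with entries
    2e, e, e, 0, where exp(2e) = exp(e)^2 is the q^2 of an element of G_1. *)
Lemma expmx_xi1 (R : realType) (i : 'I_4) (e : R) :
  expmx (e *: xi1 R i) =
  nth 0 [:: G1mx 1 e 0 0; G1mx 1 0 e 0; G1mx 1 0 0 e; G1mx (expR e) 0 0 0] i.
Proof.
have exp_delta (k : 'I_4) : k != 3 ->
    expmx (e *: delta_mx k 3) = 1 + e *: delta_mx k 3 :> 'M[R]_4.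
  move=> k3; apply: expmx_sqr0; rewrite expr2 -[LHS]/(_ *m _).
  rewrite -scalemxAl -scalemxAr mul_delta_mx_cond eq_sym (negbTE k3).
  by rewrite mulr0n !scaler0.
case: i => -[|[|[|[|//]]]] ilt; rewrite /xi1 /=.
1-3: rewrite exp_delta//; apply/matrixP => j k; rewrite !mxE.
1-3: case: j => -[|[|[|[|//]]]] jlt; case: k => -[|[|[|[|//]]]] klt;
  rewrite /= ?expr1n; ring.
rewrite -linearZ /= expmx_diag; apply/matrixP => j k; rewrite !mxE.
case: j => -[|[|[|[|//]]]] jlt; case: k => -[|[|[|[|//]]]] klt => //=.
all: rewrite /= ?mulr0 ?expR0 ?mulr1 ?mulr0n ?mulr1n//.
by rewrite expRM_natr.
Qed.

Lemma G1_expmx_xi1 (R : realType) (i : 'I_4) (e : R) :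
  G1 (expmx (e *: xi1 R i)).
Proof.
rewrite expmx_xi1; case: i => -[|[|[|[|//]]]] ilt /=.
- by exists 1, e, 0, 0.
- by exists 1, 0, e, 0.
- by exists 1, 0, 0, e.
- by exists (expR e), 0, 0, 0; rewrite expR_gt0.
Qed.

(** The fields X_1, X_2, X_3 are constant (a = 0) and X_4 is linear (b = 0). *)
Lemma flow_Xfield (R : realType) (i : 'I_4) (e : R) (p q : 'rV[R]_3) :
  flow (Xfield i) e p q <-> q = G1_act (expmx (e *: xi1 R i)) p.
Proof.
pose a (j : 'I_3) : R := [:: 2; 1; 1]`_j *+ (i == 3).
pose b (j : 'I_3) : R := (i == j :> nat)%:R.
have ab j : a j * b j = 0.
  rewrite /a /b; case: eqVneq => [->|_]; last by rewrite mul0r.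
  by rewrite gtn_eqF ?mulr0//=; case: j.
have XE p' : Xfield i p' = \row_j (a j * p' 0 j + b j).
  apply/rowP => j; rewrite mxE /a /b /Xfield.
  case: i {a b ab} => -[|[|[|[|//]]]] ilt; rewrite /= ptE;
    case: j => -[|[|[|//]]] jlt; rewrite /= /eq_op /= ?mulr1n ?mulr0n
      ?mul0r ?add0r ?addr0 ?mul1r //.
  - by congr (2 * p' 0 _); exact: val_inj.
  - by congr (p' 0 _); exact: val_inj.
  - by congr (p' 0 _); exact: val_inj.
rewrite (flow_diag_affineP _ _ _ ab XE).
suff -> : \row_j (expR (e * a j) * p 0 j + b j * e) =
    G1_act (expmx (e *: xi1 R i)) p by [].
apply/rowP => j; rewrite mxE /a /b /G1_act expmx_xi1 ptE.
have -> : p 0 j = [:: p 0 0; p 0 1; p 0 2]`_j.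
  by case: j => -[|[|[|//]]] jlt /=; congr (p 0 _); exact: val_inj.
case: i {a b ab XE} => -[|[|[|[|//]]]] ilt;
  case: j => -[|[|[|//]]] jlt;
  rewrite /par_q /par_t /par_x /par_s !mxE /= /eq_op /= ?mulr1n ?mulr0n ?mulr0
    ?expR0 ?expr1n ?mulr1 ?expRM_natr //; ring.
Qed.

(** * The space I'_1 and the action gamma_1 *)

Lemma smooth2_gamma1 (R : realType) (g : 'M[R]_4) (f : R -> R -> R) :
  smooth2 f -> smooth2 (gamma1 g f).
Proof.
move=> fs; rewrite /smooth2 /gamma1.
set q := par_q g; set t := par_t g; set x := par_x g; set s := par_s g.
have oT : open [set: 'rV[R]_2] by exact: openT.
pose a (j : 'I_2) := [:: (q ^+ 2)^-1; q^-1]`_j.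
pose b (j : 'I_2) := [:: - t / q ^+ 2; - x / q]`_j.
pose F (y : 'rV[R]_2) := f (y 0 0) (y 0 1).
pose A (y : 'rV[R]_2) : 'rV[R]_2 := \row_j (a j * y 0 j + b j).
rewrite (_ : (fun _ => _) = cst q * (F \o A) + cst s); last first.
  apply/funext => y; rewrite /F /A !fctE /= !mxE /a /b /=.
  by rewrite !mulrBl !(mulrC _^-1) !mulNr.
apply: (smooth_onD oT); last exact: (smooth_on_cst _ oT).
apply: (smooth_onM oT); first exact: (smooth_on_cst _ oT).
exact: (@smooth_on_axis_affine R 1 1 setT setT F id a b oT (fun _ _ => id)).
Qed.

(** The function f(t, x) / q is equivariant because right multiplication by an
    element of P_1 with parameters (q', 0, 0, s') multiplies q by q' and leaves
    t and x unchanged. *)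
Lemma I1'P (R : realType) (f : R -> R -> R) : I1' f <-> smooth2 f.
Proof.
split=> [[]//|fs]; split=> //.
exists (fun g => (par_q g)^-1 * f (par_t g) (par_x g)); last first.
  move=> t x; rewrite /n_tx; have [-> -> -> _] := G1mx_par 1 t x 0.
  by rewrite invr1 mul1r.
split=> [|_ p [q [t [x [s [q0 ->]]]]] [[q' [t' [x' [s' [q'0 ->]]]]]]];
  last first.
  rewrite /chi1; have [-> -> -> _] := G1mx_par q' t' x' s' => -> ->.
  rewrite G1mxM !mulr0 !add0r.
  have [-> -> -> _] := G1mx_par (q * q') t x (q * s' + s).
  have [-> -> -> _] := G1mx_par q t x s.
  by rewrite invfM mulrA [q^-1 * _]mulrC.
have := @smooth_on_coordV R 3 0; set U := (X in smooth_on X _) => qV.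
have oU : open U by exact: open_coord_gt0.
pose k (j : 'I_2) : 'I_4 := nth 0 [:: 1; 2] j.
have k_inj : injective k.
  by move=> [[|[|//]] i] [[|[|//]] j] // _; exact: val_inj.
pose F (y : 'rV[R]_2) := f (y 0 0) (y 0 1).
pose A (y : 'rV[R]_4) : 'rV[R]_2 := \row_j (1 * y 0 (k j) + 0).
rewrite /smooth_G1 (_ : (fun _ => _) =
    (fun y : 'rV[R]_4 => (y 0 0)^-1) * (F \o A)).
  apply: (smooth_onM oU qV).
  exact: (@smooth_on_axis_affine R 3 1 U setT F k (cst 1) (cst 0) oU k_inj).
apply/funext => y.
have [-> -> -> _] := G1mx_par (y 0 0) (y 0 1) (y 0 2) (y 0 3).
by rewrite !fctE /F /A /= !mxE /k /= !mul1r !addr0.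
Qed.

Lemma gamma1_is_action (R : realType) : is_action (@G1 R) (@I1' R) (@gamma1 R).
Proof.
split=> [g f _ /I1'P fs|f _|_ _ f [q [t [x [s [q0 ->]]]]]
    [q' [t' [x' [s' [q'0 ->]]]]] _].
- by apply/I1'P; exact: smooth2_gamma1.
- apply/funext => t; apply/funext => x; rewrite /gamma1 -G1mx1.
  have [-> -> -> ->] := @G1mx_par R 1 0 0 0.
  by rewrite expr1n !subr0 !divr1 mul1r addr0.
- apply/funext => u; apply/funext => v; rewrite /gamma1 G1mxM.
  have [-> -> -> ->] := G1mx_par (q * q') (q ^+ 2 * t' + t) (q * x' + x)
    (q * s' + s).
  have [-> -> -> ->] := G1mx_par q t x s.
  have [-> -> -> ->] := G1mx_par q' t' x' s'.
  have qn0 : q != 0 by rewrite gt_eqF.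
  have q'n0 : q' != 0 by rewrite gt_eqF.
  rewrite (_ : (u - (q ^+ 2 * t' + t)) / (q * q') ^+ 2 =
    ((u - t) / q ^+ 2 - t') / q' ^+ 2); last by field; rewrite ?qn0 ?q'n0.
  rewrite (_ : (v - (q * x' + x)) / (q * q') = ((v - x) / q - x') / q').
    by field; rewrite ?qn0 ?q'n0.
  by field; rewrite ?qn0 ?q'n0.
Qed.

Theorem proposition2 (R : realType) :
  globalizes (@G1 R) (@I1' R) (@gamma1 R) (@xi1 R) (@Xfield R).
Proof.
split; first exact: gamma1_is_action.
  by move=> i e; exact: G1_expmx_xi1.
move=> i f e _ _; rewrite graph_gamma1; last exact: G1_expmx_xi1.
apply/seteqP; split=> [_ [p fp <-]|q [p fp /flow_Xfield ->]].
  by exists p => //; exact/flow_Xfield.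
by exists p.
Qed.
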